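(* Let $d\ge 2$. The non-adaptive method for polyhedral approximation based on the projection operation and on efficient covering of the hypersphere is optimal in order with respect to the number of hyperfaces of the approximating polytope. That is: let $U(m)\subset S$, $m\to\infty$, be an efficient covering of the hypersphere $S$, let $C\subset E^d$ be a convex compact body with $C\subset B$, and let $P^m=P^+(C,2U(m))$. Then there is a constant $c$ such that for all sufficiently large $m$ the set $P^m$ is a compact convex polytope and $$\delta(C,P^m)\le \frac{c}{[m^f(P^m)]^{2/(d-1)}}.$$
   Context: $E^d$ is $d$-dimensional Euclidean space with scalar product $\langle\cdot,\cdot\rangle$, norm $\|\cdot\|$ and distance $\rho(\cdot,\cdot)$. $B$ is the closed unit ball centered at the origin and $S=\partial B$ is the unit sphere. A convex compact body is a compact convex set with non-empty interior. For a compact convex polytope $P\subset E^d$, $m^f(P)$ is its number of hyperfaces (faces of maximal dimension $d-1$). A method of polyhedral approximation is called optimal (in order) by the number of hyperfaces if it allows one to construct approximating polytopes $P$ with $\delta(C,P)\le c/[m^f(P)]^{2/(d-1)}$, $m^f(P)\to\infty$, for a constant $c$. A set $U$ is an $\varepsilon$-net of a set $X$ if every point of $X$ is at distance at most $\varepsilon$ from $U$ (i.e. from some point of $U$). An efficient covering of the hypersphere is a sequence of sets $U(m)\subset S$, $m\to\infty$, where $U(m)$ consists of $m$ points and is an $\varepsilon(m)$-net of $S$ for some $\varepsilon(m)>0$ with $m\le \Theta/\varepsilon(m)^{d-1}$ for a constant $\Theta$ independent of $m$. For a number $t$, $tU=\{tu:u\in U\}$. The Hausdorff distance is $\delta(C_1,C_2)=\max\{\sup\{\rho(x,C_2):x\in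 C_1\},\ \sup\{\rho(x,C_1):x\in C_2\}\}$, where $\rho(x,A)$ is the distance from a point $x$ to a set $A$. For $p\notin C$, $\mathrm{proj}(p,C)$ is the unique point of $C$ nearest to $p$, and $$F(p)=\frac{p-\mathrm{proj}(p,C)}{\|p-\mathrm{proj}(p,C)\|}\in S.$$ For $u\in S$, the support function is $g(u,C)=\max\{\langle u,x\rangle : x\in C\}$ and the support half-space is $L(u,C)=\{x\in E^d:\langle u,x\rangle\le g(u,C)\}$. For $U\subset E^d\setminus C$, $$P^+(C,U)=\bigcap\{L(u,C): u\in F(U)\}.$$ The non-adaptive method based on projection and efficient covering produces the polytopes $P^+(C,2U(m))$. *)

(* Defs.v *)
From mathcomp Require Import all_boot all_order all_algebra finmap.
From mathcomp Require Import all_classical all_reals all_analysis.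

Set Implicit Arguments.
Unset Strict Implicit.
Unset Printing Implicit Defensive.

Import Order.TTheory GRing.Theory Num.Theory.
Import numFieldNormedType.Exports.

Local Open Scope classical_set_scope.
Local Open Scope ring_scope.

(* E^d is 'rV[R]_d.  The library norm on row vectors is the sup norm, hence
   the Euclidean one is defined here; both induce the library topology, so
   [compact] and [interior] have their usual meaning. *)
Section Euclidean.
Variables (R : realType) (d : nat).
Local Notation E := 'rV[R]_d.
Implicit Types (A C G P U : set E) (p u x y : E).

Definition dot x y : R := \sum_(i < d) x 0 i * y 0 i.
Definition enorm x : R := Num.sqrt (dot x x).
Definition rho x y : R := enorm (x - y).

Definition unit_ball : set E := [set x | enorm x <= 1].
Definition unit_sphere : set E := [set x | enorm x = 1].

Definition dist_to x A : R := inf [set rho x a | a in A].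

(* [sup] and [inf] are real-valued; this is the usual Hausdorff distance for
   nonempty bounded sets. *)
Definition hausdorff_dist (A1 A2 : set E) : R :=
  Num.max (sup [set dist_to x A2 | x in A1]) (sup [set dist_to x A1 | x in A2]).

Definition convex_body C : Prop :=
  [/\ compact C, convex_set C & C° !=set0].

Definition eps_net (eps : R) U A : Prop :=
  forall x, A x -> exists2 u, U u & rho x u <= eps.

Definition efficient_covering (V : nat -> set E) : Prop :=
  exists Theta : R, \forall m \near \oo,
    [/\ V m `<=` unit_sphere, (V m #= `I_m)%card &
        exists eps : R, [/\ 0 < eps, eps_net eps (V m) unit_sphere &
                            m%:R <= Theta / eps ^+ d.-1]].

Definition dilate (t : R) U : set E := [set t *: u | u in U].

Definition proj p C : E :=
  xget 0 [set x | C x /\ forall y, C y -> rho p x <= rho p y].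

Definition unit_dir C p : E := (enorm (p - proj p C))^-1 *: (p - proj p C).

Definition support_fun u C : R := sup [set dot u x | x in C].
Definition support_halfspace u C : set E :=
  [set x | dot u x <= support_fun u C].

Definition outer_polytope C U : set E :=
  \bigcap_(u in unit_dir C @` U) support_halfspace u C.

Definition compact_convex_polytope P : Prop :=
  compact P /\
  exists (n : nat) (a : 'I_n -> E) (b : 'I_n -> R),
    P = [set x | forall i, dot (a i) x <= b i].

Definition face P G : Prop :=
  exists (a : E) (b : R), [/\ a != 0,
    (forall x, P x -> dot a x <= b) & G = P `&` [set x | dot a x = b]].

(* The affine hull of A has dimension k: it is x0 plus the span of k linearly
   independent vectors pointing from x0 to points of A. *)
Definition has_affine_dim A (k : nat) : Prop :=
  exists (x0 : E) (D : 'M[R]_(k, d)), [/\ A x0, row_free D,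
    (forall i, A (x0 + row i D)) & (forall x, A x -> (x - x0 <= D)%MS)].

Definition hyperfaces P : set (set E) :=
  [set G | face P G /\ has_affine_dim G d.-1].

(* [fset_set] of an infinite set is empty, but a polytope has finitely many
   faces. *)
Definition num_hyperfaces P : nat := #|` fset_set (hyperfaces P)|.

End Euclidean.

(* Main.v *)
Require Import Defs.
From mathcomp Require Import all_boot all_order all_algebra finmap.
From mathcomp Require Import all_classical all_reals all_analysis.
From mathcomp Require Import ring lra.

Import Order.TTheory GRing.Theory Num.Theory.
Import numFieldNormedType.Exports.

(* Let U be an eps-net of S and x a point of the outer polytope outside C, with
   nearest point p in C, outer unit normal u and h = |x - p|.  The ray from p in
   the direction u leaves the ball of radius 2 at a point q, and some v in U has
   |q - 2v| <= 2 eps.  Let p' be the nearest point to 2v, with normal u'.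
   Since the nearest-point map z |-> p(z) and z |-> z - p(z) are jointly
   nonexpansive and q, 2v are at distance at least 1 from C, both |p - p'| and
   |u - u'| are at most 2 eps.  The constraint <u', x> <= <u', p'> reads
   h <u', u> <= <u', p' - p> <= <u' - u, p' - p>, which is O(eps^2): the error
   is quadratic in eps.

   There are at most m hyperfaces, because a hyperface is cut out by a single
   one of the m defining half-spaces.  As c / 0 = 0, there must also be at least
   one, which an irredundant subfamily of half-spaces provides. *)

Local Open Scope classical_set_scope.
Local Open Scope ring_scope.

Local Notation proj := Defs.proj.

(** * The scalar product and the Euclidean norm *)

Section Dot.
Context {R : realType} {d : nat}.
Implicit Types (p q u v w x y z : 'rV[R]_d) (C : set 'rV[R]_d).

Lemma dotC x y : dot x y = dot y x.
Proof. by apply: eq_bigr => i _; rewrite mulrC. Qed.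

Lemma dotDl x y z : dot (x + y) z = dot x z + dot y z.
Proof. by rewrite -big_split; apply: eq_bigr => i _; rewrite mxE mulrDl. Qed.

Lemma dotZl t x y : dot (t *: x) y = t * dot x y.
Proof. by rewrite mulr_sumr; apply: eq_bigr => i _; rewrite mxE mulrA. Qed.

Lemma dotNl x y : dot (- x) y = - dot x y.
Proof. by rewrite -scaleN1r dotZl mulN1r. Qed.

Lemma dotBl x y z : dot (x - y) z = dot x z - dot y z.
Proof. by rewrite dotDl dotNl. Qed.

Lemma dotDr x y z : dot x (y + z) = dot x y + dot x z.
Proof. by rewrite dotC dotDl !(dotC _ x). Qed.

Lemma dotZr t x y : dot x (t *: y) = t * dot x y.
Proof. by rewrite dotC dotZl dotC. Qed.

Lemma dotNr x y : dot x (- y) = - dot x y.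
Proof. by rewrite dotC dotNl dotC. Qed.

Lemma dotBr x y z : dot x (y - z) = dot x y - dot x z.
Proof. by rewrite dotC dotBl !(dotC _ x). Qed.

Definition dotE := (dotDl, dotDr, dotNl, dotNr, dotZl, dotZr).

Lemma dot_mulmx x y : x *m y^T = (dot x y)%:M.
Proof.
rewrite [LHS]mx11_scalar mxE; congr _%:M.
by apply: eq_bigr => i _; rewrite mxE.
Qed.

Lemma dot_ge0 x : 0 <= dot x x.
Proof. by apply: sumr_ge0 => i _; rewrite -expr2 sqr_ge0. Qed.

Lemma dot_coord_le x i : x 0 i ^+ 2 <= dot x x.
Proof.
rewrite /dot (bigD1 i)//= expr2 lerDl.
by apply: sumr_ge0 => j _; rewrite -expr2 sqr_ge0.
Qed.

Lemma dot_gt0 x : x != 0 -> 0 < dot x x.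
Proof.
move=> x0; rewrite lt_neqAle dot_ge0 andbT eq_sym.
apply: contraNneq x0 => xx0; apply/eqP/rowP => i; rewrite mxE.
apply/eqP; rewrite -sqrf_eq0 eq_le sqr_ge0 andbT -xx0.
exact: dot_coord_le.
Qed.

Lemma dot_amgm x y : 2 * dot x y <= dot x x + dot y y.
Proof. by have := dot_ge0 (x - y); rewrite !dotE (dotC y x); lra. Qed.

Lemma enorm_ge0 x : 0 <= enorm x.
Proof. exact: sqrtr_ge0. Qed.

Lemma enorm_sqr x : enorm x ^+ 2 = dot x x.
Proof. exact/sqr_sqrtr/dot_ge0. Qed.

Lemma enorm_le x r : 0 <= r -> (enorm x <= r) = (dot x x <= r ^+ 2).
Proof.
by move=> r0; rewrite -(ler_pXn2r (n:=2))// ?nnegrE ?enorm_ge0// enorm_sqr.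
Qed.

Lemma enorm_eq1 x : (enorm x == 1) = (dot x x == 1).
Proof. by rewrite -enorm_sqr sqrp_eq1 ?enorm_ge0. Qed.

Lemma dot_comp_continuous (T : topologicalType) (f g : T -> 'rV[R]_d) :
  continuous f -> continuous g -> continuous (fun t => dot (f t) (g t)).
Proof.
have coord (h : T -> 'rV[R]_d) i :
    continuous h -> continuous (fun t => h t 0 i).
  move=> ch x; apply: (continuous_comp (g := fun M : 'rV[R]_d => M 0 i) (ch x)).
  exact: coord_continuous.
move=> cf cg; apply: continuous_big => [|i _ x].
  by move=> y; exact: add_continuous.
exact: cvgM (coord _ _ cf x) (coord _ _ cg x).
Qed.


(** * Nearest points and supporting half-spaces of a compact convex set *)

Lemma convex_set_segment C x y t : convex_set C -> C x -> C y ->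
  0 <= t <= 1 -> C (x + t *: (y - x)).
Proof.
move=> cC Cx Cy /andP[t0 t1].
have := cC y x (Itv01 t0 t1); rewrite !inE => /(_ Cy Cx).
have -> : x + t *: (y - x) = t *: y + (1 - t) *: x.
  by rewrite scalerBl scalerBr scale1r addrCA.
by [].
Qed.

(** By compactness the continuous squared distance attains its minimum on [C], so the default value
    0 of [xget] never occurs. *)
Lemma proj_nearest p C : compact C -> C !=set0 ->
  C (proj p C) /\ forall y, C y -> rho p (proj p C) <= rho p y.
Proof.
move=> cC C0; rewrite /proj; case: xgetP => [//|noproj].
have cf : continuous (fun x => dot (p - x) (p - x)).
  have cB : continuous (fun x => p - x).
    by move=> x; exact: (cvgB (cvg_cst p) (@cvg_id _ (nbhs x))).
  exact: dot_comp_continuous.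
have [c cC' cmin] := EVT_min_rV C0 cC (continuous_subspaceT cf).
exfalso; apply: (noproj c); split; first exact/set_mem.
by move=> y Cy; apply: ler_wsqrtr; apply/cmin/mem_set.
Qed.

Lemma proj_obtuse p C y : compact C -> convex_set C -> C y ->
  dot (p - proj p C) (y - proj p C) <= 0.
Proof.
move=> cC vC Cy; have [Cp pmin] := proj_nearest p C cC (ex_intro _ y Cy).
set q := proj p C in Cp pmin *.
have segmin t : 0 <= t <= 1 ->
    2 * (t * dot (p - q) (y - q)) <= t * (t * dot (y - q) (y - q)).
  move=> t01; have := pmin _ (convex_set_segment C q y t vC Cp Cy t01).
  rewrite /rho enorm_le ?enorm_ge0// enorm_sqr opprD addrA.
  rewrite [dot (p - q - _) _]dotBl !(dotBr _ (p - q)) !dotZl !dotZr.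
  by rewrite (dotC (y - q) (p - q)); lra.
rewrite leNgt; apply/negP => A_gt0.
have B_ge0 := dot_ge0 (y - q).
set A := dot (p - q) _ in A_gt0 segmin; set B := dot (y - q) _ in B_ge0 segmin.
have AB_gt0 : 0 < A + B by lra.
(* At [t = A / (A + B)] the minimality inequality gives [2 A <= t B], while [t B <= A]: impossible
   for [A > 0]. This value lies in the unit interval even if [B = 0]. *)
have t_gt0 : 0 < A / (A + B) by rewrite divr_gt0.
have /segmin : 0 <= A / (A + B) <= 1.
  by rewrite ltW//= ler_pdivrMr// mul1r; lra.
rewrite mulrCA ler_pM2l// mulrAC ler_pdivlMr//; nra.
Qed.

(** By the obtuse-angle inequality the linear form of the outer direction is maximal on [C] at the
    nearest point. For [p] in [C] the direction is 0 and both sides vanish. *)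
Lemma support_fun_unit_dir p C : compact C -> convex_set C -> C !=set0 ->
  support_fun (unit_dir C p) C = dot (unit_dir C p) (proj p C).
Proof.
move=> cC vC C0; have [Cp _] := proj_nearest p C cC C0.
have ub : ubound [set dot (unit_dir C p) x | x in C]
    (dot (unit_dir C p) (proj p C)).
  move=> _ [x Cx <-]; rewrite -subr_le0 -dotBr dotZl.
  by rewrite mulr_ge0_le0 ?invr_ge0 ?enorm_ge0// proj_obtuse.
apply/eqP; rewrite eq_le; apply/andP; split.
  by apply: ge_sup => //; exists (dot (unit_dir C p) (proj p C)), (proj p C).
by apply: ub_le_sup; [exists (dot (unit_dir C p) (proj p C))|exists (proj p C)].
Qed.

Lemma support_halfspace_sub p C : compact C -> convex_set C ->
  C `<=` support_halfspace (unit_dir C p) C.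
Proof.
move=> cC vC x Cx; rewrite /support_halfspace/= support_fun_unit_dir//.
  rewrite -subr_le0 -dotBr dotZl.
  by rewrite mulr_ge0_le0 ?invr_ge0 ?enorm_ge0// proj_obtuse.
by exists x.
Qed.

Lemma subset_outer_polytope C (V : set 'rV[R]_d) : compact C -> convex_set C ->
  C `<=` outer_polytope C V.
Proof. by move=> cC vC x Cx _ [p _ <-]; exact: support_halfspace_sub. Qed.

(** * The quadratic estimate for the distance from the outer polytope to the body *)

(* [p] and [p'] are the nearest points to [p + w] and [p' + w'] of a convex
   set. *)
Lemma normal_pairs_le p p' w w' : dot w (p' - p) <= 0 -> dot w' (p - p') <= 0 ->
  dot (p - p') (p - p') + dot (w - w') (w - w') <=
  dot (p + w - (p' + w')) (p + w - (p' + w')).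
Proof.
rewrite !dotE (dotC w p) (dotC w p') (dotC w' p) (dotC w' p').
by rewrite (dotC p' p) (dotC w' w); lra.
Qed.

(** Radial projection to the unit sphere does not increase distances outside the ball: with
    [c = dot u u'], the right side minus the left is [(s - s')^2 + 2 (s s' - 1)(1 - c)]. *)
Lemma dot_scaled_unit_le u u' s s' : dot u u = 1 -> dot u' u' = 1 ->
  1 <= s -> 1 <= s' ->
  dot (u - u') (u - u') <= dot (s *: u - s' *: u') (s *: u - s' *: u').
Proof.
move=> u1 u'1 s1 s'1; rewrite !dotE (dotC u' u) u1 u'1.
have c_le1 : dot u u' <= 1 by have := dot_amgm u u'; rewrite u1 u'1; lra.
have : 0 <= (s * s' - 1) * (1 - dot u u').
  by rewrite mulr_ge0 ?subr_ge0//; nra.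
by have := sqr_ge0 (s - s'); nra.
Qed.

Lemma unit_dirP p C : proj p C != p ->
  dot (unit_dir C p) (unit_dir C p) = 1 /\
  p - proj p C = enorm (p - proj p C) *: unit_dir C p.
Proof.
rewrite eq_sym -subr_eq0 => w0.
have ew : enorm (p - proj p C) != 0.
  by rewrite -sqrf_eq0 enorm_sqr; have := dot_gt0 _ w0; lra.
split; last by rewrite scalerA mulfV// scale1r.
by rewrite dotZl dotZr -enorm_sqr expr2 mulKf// mulVf.
Qed.

(** Expanding [|q - 2y|^2 >= 0] bounds the cross term and yields [|q - y|^2 >= 2 - |y|^2]. *)
Lemma dot_sub_sphere2_ge1 q y : dot q q = 4 -> dot y y <= 1 ->
  1 <= dot (q - y) (q - y).
Proof.
move=> q4 y1; have := dot_ge0 (q - 2 *: y).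
by rewrite !dotE (dotC y q); lra.
Qed.

Lemma ray_meets_sphere2 p u : dot p p <= 1 -> dot u u = 1 ->
  exists2 s, 1 <= s & dot (p + s *: u) (p + s *: u) = 4.
Proof.
(* The witness [Num.sqrt D - b] is the larger root of [s^2 + 2 b s + |p|^2 - 4 = 0]. It is
   nonnegative, and it equals the distance from [p] to the sphere point, hence is at least 1. *)
move=> p1 u1; pose b := dot p u; pose D := b ^+ 2 + 4 - dot p p.
have D_ge : b ^+ 2 <= D by rewrite /D; lra.
have sD : Num.sqrt D ^+ 2 = D.
  by rewrite sqr_sqrtr// (le_trans _ D_ge)// sqr_ge0.
have s_ge0 : 0 <= Num.sqrt D - b.
  rewrite subr_ge0; apply: le_trans (ler_norm _) _.
  by rewrite -sqrtr_sqr ler_wsqrtr.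
exists (Num.sqrt D - b); last first.
  by rewrite !dotE (dotC u p) u1 -/b; rewrite /D in sD; nra.
set s := _ - b in s_ge0 *.
have : dot (p + s *: u) (p + s *: u) = 4.
  by rewrite !dotE (dotC u p) u1 -/b /s; rewrite /D in sD; nra.
move=> /dot_sub_sphere2_ge1 /(_ p1).
by rewrite addrAC subrr add0r dotZl dotZr u1 mulr1; nra.
Qed.

Lemma halfspace_gap p p' u u' s s' h eps :
  dot u u = 1 -> dot u' u' = 1 -> 1 <= s -> 1 <= s' -> 0 <= h ->
  0 < eps <= 1 / 2 -> dot u (p' - p) <= 0 -> dot u' (p - p') <= 0 ->
  dot (p + s *: u - (p' + s' *: u')) (p + s *: u - (p' + s' *: u'))
    <= 4 * eps ^+ 2 ->
  dot u' (p + h *: u) <= dot u' p' -> h <= 8 * eps ^+ 2.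
Proof.
move=> u1 u'1 s1 s'1 h_ge0 /andP[eps_gt0 eps_le] obt obt' close cut.
have obt_s : dot (s *: u) (p' - p) <= 0.
  by rewrite dotZl mulr_ge0_le0 ?(le_trans ler01).
have obt_s' : dot (s' *: u') (p - p') <= 0.
  by rewrite dotZl mulr_ge0_le0 ?(le_trans ler01).
(* Nonexpansiveness: the squared distance of the outer points exceeds the sum of the two squares by
   [2 <w - w', p - p'>], which the obtuse angles make nonnegative. *)
have near_pairs := le_trans (normal_pairs_le _ _ _ _ obt_s obt_s') close.
have uu' := dot_scaled_unit_le u u' s s' u1 u'1 s1 s'1.
have pp'_ge0 := dot_ge0 (p - p').
have ww'_ge0 := dot_ge0 (s *: u - s' *: u').
have gap : h * dot u' u <= dot (u - u') (p - p') + dot u (p' - p).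
  by move: cut; rewrite !dotE; lra.
have amgm := dot_amgm (u - u') (p - p').
have uu'E : dot (u - u') (u - u') = 2 - 2 * dot u' u.
  by rewrite !dotE u1 u'1 (dotC u u'); ring.
have eps2 : eps ^+ 2 <= 1 / 4.
  rewrite [leRHS](_ : _ = (1 / 2) ^+ 2); last by field.
  by rewrite ler_pXn2r ?nnegrE// ltW.
(* Since [eps <= 1/2], [|u - u'|^2 <= 1] and so [dot u' u >= 1/2]. The right side of [gap] is at
   most half the sum of the two squares, hence at most [2 eps^2]. *)
have : h * (1 / 2) <= h * dot u' u by rewrite ler_wpM2l//; lra.
lra.
Qed.

Lemma outer_polytope_near C (V : set 'rV[R]_d) eps x :
  compact C -> convex_set C -> C !=set0 -> C `<=` @unit_ball R d ->
  V `<=` @unit_sphere R d -> 0 < eps <= 1 / 2 ->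
  eps_net eps V (@unit_sphere R d) ->
  outer_polytope C (dilate 2 V) x -> rho x (proj x C) <= 8 * eps ^+ 2.
Proof.
move=> cC vC C0 CB VS eps_itv Vnet Px.
have /andP[eps_gt0 _] := eps_itv.
have [Cp _] := proj_nearest x C cC C0.
have dotCB y : C y -> dot y y <= 1.
  by move=> /CB; rewrite /unit_ball/= enorm_le// expr1n.
have [->|px] := eqVneq (proj x C) x.
  rewrite /rho subrr /enorm -(scale0r 0) dotZl mul0r sqrtr0.
  by rewrite mulr_ge0// sqr_ge0.
have [u1 xpE] := unit_dirP x C px.
have [s s1 q4] := ray_meets_sphere2 _ _ (dotCB _ Cp) u1.
(* The net lies on the unit sphere, so the point of the sphere of radius 2 is halved first; scaling
   back doubles the error to [2 eps]. *)
have [v Vv qv] : exists2 v, V v &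
    rho (2^-1 *: (proj x C + s *: unit_dir C x)) v <= eps.
  apply: Vnet; apply/eqP; rewrite enorm_eq1 dotZl dotZr q4.
  by apply/eqP; field.
have vv : dot v v = 1 by apply/eqP; rewrite -enorm_eq1; apply/eqP/VS.
have [Cp' _] := proj_nearest (2 *: v) C cC C0.
have v4 : dot (2 *: v) (2 *: v) = 4 by rewrite dotZl dotZr vv; ring.
have w'_ge1 := dot_sub_sphere2_ge1 _ _ v4 (dotCB _ Cp').
have p'v : proj (2 *: v) C != 2 *: v.
  rewrite eq_sym -subr_eq0; apply: contraTneq w'_ge1 => ->.
  by rewrite -(scale0r 0) dotZl mul0r ler10.
have [u'1 w'E] := unit_dirP (2 *: v) C p'v.
have obtuse z y : C y -> dot (unit_dir C z) (y - proj z C) <= 0.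
  move=> Cy; rewrite dotZl mulr_ge0_le0 ?invr_ge0 ?enorm_ge0//.
  exact: proj_obtuse.
rewrite /rho xpE.
have -> : enorm (enorm (x - proj x C) *: unit_dir C x) = enorm (x - proj x C).
  by rewrite -xpE.
apply: (halfspace_gap _ _ _ _ _ (enorm (2 *: v - proj (2 *: v) C)) _ _
  u1 u'1 s1 _ _ eps_itv (obtuse _ _ Cp') (obtuse _ _ Cp)).
- rewrite -(ler_pXn2r (n:=2)) ?nnegrE ?enorm_ge0// expr1n enorm_sqr.
  exact: w'_ge1.
- exact: enorm_ge0.
- rewrite -w'E [proj (2 *: v) C + _]addrC subrK.
  rewrite [_ - _](_ : _ = 2 *: (2^-1 *: (proj x C + s *: unit_dir C x) - v)).
    rewrite dotZl dotZr; move: qv; rewrite /rho enorm_le ?(ltW eps_gt0)//.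
    by move: (dot _ _) => D; lra.
  by rewrite scalerBr (scalerA 2 2^-1) divff ?scale1r.
- rewrite -xpE [proj x C + _]addrC subrK -support_fun_unit_dir//; apply: Px.
  by exists (2 *: v) => //; exists v.
Qed.

End Dot.

(** * Hyperfaces of a polyhedron given by finitely many half-spaces *)

Section Polytope.
Context {R : realType} {d : nat}.
Implicit Types (p q u v w x y z : 'rV[R]_d).

Definition hpoly {n} (a : 'I_n -> 'rV[R]_d) (b : 'I_n -> R) : set 'rV[R]_d :=
  [set x | forall i, dot (a i) x <= b i].

Lemma positive_lower_bound (I : finType) (s : I -> R) :
  (forall i, 0 < s i) -> exists2 t, 0 < t & forall i, t <= s i.
Proof.
move=> s_gt0; exists (\big[Num.min/1]_i s i).
  by apply/bigmin_gtP; split.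
by move=> i; exact: bigmin_le_cond.
Qed.

(** One step length serves all finitely many pairs of a strict constraint and a direction. The 1
    added to the denominator keeps the quotient of slack by slope defined; pairs outside [Q] get a
    dummy value. *)
Lemma small_steps (I J : finType) (Q : pred I) (a : I -> 'rV[R]_d) (b : I -> R)
    (v : J -> 'rV[R]_d) x :
  (forall i, Q i -> dot (a i) x < b i) ->
  exists2 t, 0 < t & forall i j, Q i -> dot (a i) (x + t *: v j) <= b i.
Proof.
move=> slack.
pose s (k : I * J) := if Q k.1 then
  (b k.1 - dot (a k.1) x) / (1 + `|dot (a k.1) (v k.2)|) else 1.
have [k|t t_gt0 ts] := positive_lower_bound _ s.
  rewrite /s; case: ifP => // Qk.
  by rewrite divr_gt0 ?subr_gt0 ?slack// ltr_pwDl.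
exists t => // i j Qi; have := ts (i, j).
rewrite /s/= Qi ler_pdivlMr ?ltr_pwDl// dotDr dotZr.
have := ler_norm (dot (a i) (v j)); nra.
Qed.

(** The orthogonal complement of the rows has dimension at most 1, so the nonzero [u] spans it. *)
Lemma common_normal_sub k (D : 'M[R]_(k, d)) u v :
  (d <= k.+1)%N -> row_free D -> u != 0 ->
  (forall j, dot u (row j D) = 0) -> (forall j, dot v (row j D) = 0) ->
  (v <= u)%MS.
Proof.
move=> dk Dfree u0 uD vD.
have subker w : (forall j, dot w (row j D) = 0) -> (w <= kermx D^T)%MS.
  move=> wD; apply/sub_kermxP/rowP => j; rewrite !mxE -[RHS](wD j).
  by apply: eq_bigr => l _; rewrite !mxE.
apply: submx_trans (subker _ vD) _.
have [_ eqr] := mxrank_leqif_sup (subker _ uD).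
rewrite -eqr eqn_leq mxrankS ?subker//= rank_rV u0 mxrank_ker mxrank_tr.
by rewrite (eqP Dfree) leq_subLR addn1.
Qed.

Section Hpoly.
Context {n : nat} (a : 'I_n -> 'rV[R]_d) (b : 'I_n -> R).

Lemma hpoly_closed : closed (hpoly a b).
Proof.
have -> : hpoly a b = \bigcap_(i in setT) (dot (a i) @^-1` [set t | t <= b i]).
  by apply/seteqP; split=> [x Px i _|x Px i]; [exact: Px|exact: Px].
apply: closed_bigI => i _; apply: preimage_closed (@closed_le R (b i)) => x _.
apply: (dot_comp_continuous _ (fun=> a i) id).
  exact: cst_continuous.
by move=> y; exact: cvg_id.
Qed.

(** If all constraints were strict at the barycentre [y], a small step along [u] would stay in the
    polyhedron and push [dot u] above [c]. A constraint tight at [y] is tight at every point,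
    because its slack at [y] averages nonnegative slacks. *)
Lemma hpoly_common_tight {k} (pts : 'I_k.+1 -> 'rV[R]_d) u c :
  u != 0 -> (forall x, hpoly a b x -> dot u x <= c) ->
  (forall j, hpoly a b (pts j)) -> (forall j, dot u (pts j) = c) ->
  exists i, forall j, dot (a i) (pts j) = b i.
Proof.
move=> u0 uP ptsP ptsu.
pose N : R := k.+1%:R; have N_gt0 : 0 < N by rewrite ltr0n.
pose y := N^-1 *: \sum_j pts j.
have dot_y v e : N * (e - dot v y) = \sum_j (e - dot v (pts j)).
  rewrite sumrB sumr_const card_ord -[e *+ _]mulr_natl mulrBr; congr (_ - _).
  rewrite dotZr mulrA mulfV ?gt_eqF// mul1r.
  apply: (big_morph (dot v)) => [x z|]; first exact: dotDr.
  by rewrite -(scale0r 0) dotZr mul0r.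
have [[i tight]|nontight] := pselect (exists i, dot (a i) y = b i).
  exists i => j; have := dot_y (a i) (b i); rewrite tight subrr mulr0.
  have slack_ge0 l : true -> 0 <= b i - dot (a i) (pts l).
    by move=> _; rewrite subr_ge0; exact: ptsP.
  move=> /esym/(psumr_eq0P slack_ge0)/(_ j isT)/eqP.
  by rewrite subr_eq0 => /eqP.
have slack i : dot (a i) y < b i.
  rewrite lt_neqAle; apply/andP; split.
    by apply/eqP => tight; apply: nontight; exists i.
  rewrite -subr_ge0 -(pmulr_rge0 _ N_gt0) dot_y.
  by apply: sumr_ge0 => j _; rewrite subr_ge0; exact: ptsP.
have [t t_gt0 tP] := small_steps _ _ predT a b (fun _ : 'I_1 => u) y
  (fun i _ => slack i).
have uy : dot u y = c.
  apply/eqP; rewrite eq_sym -subr_eq0 -(mulrI_eq0 _ (mulfI (lt0r_neq0 N_gt0))).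
  by rewrite dot_y big1// => j _; rewrite ptsu subrr.
have := uP _ (fun i => tP i ord0 isT).
have := mulr_gt0 t_gt0 (dot_gt0 _ u0).
by rewrite dotDr uy dotZr; lra.
Qed.

(** Some constraint is tight at [d] affinely independent points of the hyperface. Its normal and [u]
    are then both orthogonal to [d.-1] independent directions, hence proportional, and the two
    hyperplanes coincide. *)
Lemma hyperface_tight (G : set 'rV[R]_d) : (forall i, a i != 0) ->
  hyperfaces (hpoly a b) G ->
  exists i, G = hpoly a b `&` [set x | dot (a i) x = b i].
Proof.
move=> a0 [[u [c [u0 uP ->]]] [x0 [D [[Px0 ux0] Dfree GD _]]]].
pose pts (j : 'I_d.-1.+1) :=
  if unlift ord0 j is Some k then x0 + row k D else x0.
have ptsG j : (hpoly a b `&` [set x | dot u x = c]) (pts j).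
  by rewrite /pts; case: unliftP => [k _|_]; [exact: GD|split].
have [i tight] := hpoly_common_tight pts u c u0 uP
  (fun j => (ptsG j).1) (fun j => (ptsG j).2).
have ix0 : dot (a i) x0 = b i by have := tight ord0; rewrite /pts unlift_none.
have iD j : dot (a i) (row j D) = 0.
  have := tight (lift ord0 j); rewrite /pts liftK dotDr ix0.
  by move/eqP; rewrite -subr_eq0 addrAC subrr add0r => /eqP.
have uD j : dot u (row j D) = 0.
  have := (ptsG (lift ord0 j)).2; rewrite /pts/= liftK dotDr ux0.
  by move/eqP; rewrite -subr_eq0 addrAC subrr add0r => /eqP.
have /sub_rVP[l ul] :=
  common_normal_sub _ _ _ _ (leqSpred d) Dfree (a0 i) iD uD.
have l0 : l != 0 by apply: contra_neq u0 => l0; rewrite ul l0 scale0r.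
exists i; congr (_ `&` _); apply/seteqP.
rewrite -ux0 -ix0 ul; split=> x /=; rewrite !dotZl; first exact: mulfI.
by move=> ->.
Qed.

(** In a minimal subfamily [I] defining the polyhedron, dropping [i] admits a point [y] violating
    constraint [i]. The segment from the interior point [z] to [y] meets the hyperplane of [i] at a
    point [w] where the other constraints of [I] are strict, so a small piece of that hyperplane
    around [w] lies in the polyhedron. *)
Lemma exists_hyperface : (forall i, a i != 0) ->
  hpoly a b != setT -> (exists z, forall i, dot (a i) z < b i) ->
  hyperfaces (hpoly a b) !=set0.
Proof.
move=> a0 PT [z zint].
pose cut (I : {set 'I_n}) := [set x | forall i, i \in I -> dot (a i) x <= b i].
have cutT : `[< cut [set: 'I_n]%SET = hpoly a b >].
  apply/asboolP/seteqP; split=> x Px i; last by move=> _; exact: Px.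
  by apply: Px; rewrite inE.
have [I /minsetP[/asboolP cutI Imin]] := ex_minset
  (ex_intro (fun I => `[< cut I = hpoly a b >]) _ cutT).
have [I0|[i iI]] := set_0Vmem I.
  case/eqP: PT; rewrite -cutI I0; apply/seteqP; split=> // x _ j.
  by rewrite inE.
have [y cuty /negP] : exists2 y, cut (I :\ i)%SET y & ~~ (dot (a i) y <= b i).
  apply: contrapT => no_y.
  have /Imin/(_ (subsetDl _ _)) Ii : `[< cut (I :\ i)%SET = hpoly a b >].
    apply/asboolP; rewrite -cutI; apply/seteqP; split=> x cx j.
      move=> jI; have [->|ji] := eqVneq j i; last by apply: cx; rewrite !inE ji.
      by apply: contrapT => /negP nx; apply: no_y; exists x.
    by rewrite !inE => /andP[_ jI]; exact: cx.
  by move: iI; rewrite -Ii !inE eqxx.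
move=> /negP; rewrite -ltNge => yi; have zi := zint i.
(* This [t] solves [dot (a i) (z + t *: (y - z)) = b i]; as [t < 1], the strict slack at [z]
   survives at [w]. *)
pose t := (b i - dot (a i) z) / (dot (a i) y - dot (a i) z).
have yz_gt0 : 0 < dot (a i) y - dot (a i) z by rewrite subr_gt0 (lt_trans zi).
have t_gt0 : 0 < t by rewrite divr_gt0// subr_gt0.
have t_lt1 : t < 1 by rewrite ltr_pdivrMr// mul1r ltrD2r.
pose w := z + t *: (y - z).
have wi : dot (a i) w = b i.
  by rewrite dotDr dotZr dotBr divfK ?gt_eqF// addrC subrK.
have wj j : j \in (I :\ i)%SET -> dot (a j) w < b j.
  move=> jI; rewrite dotDr dotZr dotBr; have := zint j; have := cuty _ jI.
  nra.
(* The directions in the hyperplane of [i]: a small multiple of a basis of [K], attached at [w],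
   witnesses dimension [d.-1]. *)
pose K := kermx (a i)^T.
have Krank : \rank K = d.-1.
  by rewrite mxrank_ker mxrank_tr rank_rV a0 subn1.
have Ki x : (x <= K)%MS = (dot (a i) x == 0).
  rewrite dotC; apply/sub_kermxP/eqP; rewrite dot_mulmx.
    by move/rowP/(_ 0); rewrite !mxE eqxx mulr1n.
  by move=> ->; rewrite raddf0.
have [e e_gt0 eP] := small_steps _ _ _ a b (fun j => row j (row_base K)) w wj.
have inP x : dot (a i) x = b i -> (forall j, j \in (I :\ i)%SET ->
    dot (a j) x <= b j) -> hpoly a b x.
  rewrite -cutI => xi xj j jI; have [->|ji] := eqVneq j i; first by rewrite xi.
  by apply: xj; rewrite !inE ji.
exists (hpoly a b `&` [set x | dot (a i) x = b i]); split.
  by exists (a i), (b i); split=> // x; exact.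
rewrite -Krank; exists w, (e *: row_base K); split.
- by split=> //; apply: inP => // j /wj/ltW.
- by rewrite /row_free mxrank_scale_nz ?lt0r_neq0//; exact: row_base_free.
- move=> j; rewrite linearZ/=.
  have tight : dot (a i) (w + e *: row j (row_base K)) = b i.
    rewrite dotDr wi dotZr.
    have /eqP -> : dot (a i) (row j (row_base K)) == 0.
      by rewrite -Ki (submx_trans (row_sub _ _))// eq_row_base.
    by rewrite mulr0 addr0.
  by split=> //; apply: inP => // l /eP; exact.
- move=> x [_ xi]; rewrite eqmx_scale ?gt_eqF// eq_row_base Ki.
  by rewrite dotBr xi wi subrr.
Qed.

Lemma num_hyperfaces_bounds : (forall i, a i != 0) ->
  hpoly a b != setT -> (exists z, forall i, dot (a i) z < b i) ->
  (0 < num_hyperfaces (hpoly a b) <= n)%N.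
Proof.
move=> a0 PT zint.
(* Hyperfaces lie in the image of the constraint indices under [h]. This also gives their
   finiteness, without which [fset_set] would be empty and the lower bound would fail. *)
pose h (k : nat) : set 'rV[R]_d := if insub k is Some i then
  hpoly a b `&` [set x | dot (a i) x = b i] else set0.
have le_n : (hyperfaces (hpoly a b) #<= `I_n)%card.
  apply: card_le_trans (card_image_le h _); apply: subset_card_le => G.
  move=> /(hyperface_tight _ a0)[i ->]; exists i => //=.
  by rewrite /h valK.
rewrite /num_hyperfaces (geq_card_fset_set le_n) andbT.
have [G GP] := exists_hyperface a0 PT zint.
apply: leq_card_fset_set; first by apply/finite_set_leP; exists n.
apply: card_le_trans (@subset_card_le _ [set G] _ _).
  by have /card_eqPle[] := @card_set1 _ G.
by move=> _ ->.
Qed.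

End Hpoly.
End Polytope.

(** * Boundedness and the Hausdorff distance *)

Section Distances.
Context {R : realType} {d : nat}.
Implicit Types (p q u v w x y z : 'rV[R]_d) (A C P : set 'rV[R]_d).

(** [bounded_set] refers to the sup norm, which is dominated by the Euclidean one coordinate by
    coordinate. *)
Lemma dot_bounded_set A (r : R) : (forall x, A x -> dot x x <= r ^+ 2) ->
  bounded_set A.
Proof.
move=> Ar; exists `|r|; split; first exact: num_real.
move=> M rM x /Ar xr; rewrite /= [leLHS]mx_normrE.
apply/bigmax_leP; split; first by rewrite (le_trans (normr_ge0 r)) ?ltW.
move=> [i j] _ /=; rewrite ord1 (le_trans _ (ltW rM))// -ler_sqr ?nnegrE//.
by rewrite !real_normK ?num_real// (le_trans (dot_coord_le x j)).
Qed.

Lemma interior_shift C z v : C° z -> exists2 t, 0 < t & C (z + t *: v).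
Proof.
move=> /nbhs_ballP[e e_gt0 zC].
have v_gt0 : 0 < 1 + `|v| by rewrite ltr_pwDl.
exists (e / (1 + `|v|)); first by rewrite divr_gt0.
apply: zC; rewrite -ball_normE/= opprD addrA subrr add0r normrN normrZ.
rewrite ger0_norm ?divr_ge0// ?(ltW e_gt0)// ?(ltW v_gt0)//.
by rewrite mulrAC ltr_pdivrMr// ltr_pM2l// ltrDr.
Qed.

Lemma rho_ge0 x y : 0 <= rho x y.
Proof. exact: enorm_ge0. Qed.

Lemma dist_to_le x y A : A y -> dist_to x A <= rho x y.
Proof.
by move=> Ay; apply: ge_inf; [exists 0 => _ [z _ <-]; exact: rho_ge0|exists y].
Qed.

Lemma rhoxx x : rho x x = 0.
Proof. by rewrite /rho subrr /enorm -(scale0r 0) dotZl mul0r sqrtr0. Qed.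

Lemma hausdorff_dist_le A P (r : R) : 0 <= r -> A !=set0 -> A `<=` P ->
  (forall x, P x -> exists2 y, A y & rho x y <= r) -> hausdorff_dist A P <= r.
Proof.
move=> r_ge0 [x0 Ax0] AP Pr; rewrite ge_max; apply/andP; split.
  apply: ge_sup => [|_ [x Ax <-]]; first by exists (dist_to x0 P), x0.
  by rewrite (le_trans (dist_to_le x x P (AP _ Ax)))// rhoxx.
apply: ge_sup => [|_ [x Px <-]]; last first.
  by have [y Ay xy] := Pr x Px; exact: le_trans (dist_to_le x y A Ay) xy.
by exists (dist_to x0 A), x0 => //; exact: AP.
Qed.

(** With [eps <= 1/2] every point is within 2 of the unit ball; the crude bound [|x|^2 <= 2 (4 + 1)]
    is already below 16. *)
Lemma outer_polytope_bounded C (V : set 'rV[R]_d) (eps : R) x :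
  compact C -> convex_set C -> C !=set0 -> C `<=` @unit_ball R d ->
  V `<=` @unit_sphere R d -> 0 < eps <= 1 / 2 ->
  eps_net eps V (@unit_sphere R d) ->
  outer_polytope C (dilate 2 V) x -> dot x x <= 4 ^+ 2.
Proof.
move=> cC vC C0 CB VS eps_itv Vnet Px.
have [Cp _] := proj_nearest x C cC C0.
have := outer_polytope_near C V eps x cC vC C0 CB VS eps_itv Vnet Px.
have := CB _ Cp; rewrite /unit_ball/= enorm_le// expr1n => p1.
have /andP[eps_gt0 eps_le] := eps_itv.
have eps2 : eps ^+ 2 <= 1 / 4.
  rewrite [leRHS](_ : _ = (1 / 2) ^+ 2); last by field.
  by rewrite ler_pXn2r ?nnegrE// ltW.
rewrite /rho => near; have {near} : enorm (x - proj x C) <= 2.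
  by apply: le_trans near _; lra.
rewrite enorm_le// => xp2; have := dot_amgm (x - proj x C) (proj x C).
move: xp2 p1; set p := proj x C; set D := dot (x - p) (x - p).
have -> : D = dot x x - 2 * dot x p + dot p p.
  by rewrite /D !dotE (dotC p x); ring.
by rewrite dotBl; lra.
Qed.

End Distances.

(** * From the covering radius to the number of hyperfaces *)

(** Here [N eps^k <= m eps^k <= Theta]; raising to the power [2/k] turns [eps^k] into [eps^2]. *)
Lemma powR_covering_bound (R : realType) (k m N : nat) (Theta eps : R) :
  (0 < k)%N -> (0 < N <= m)%N -> 0 < eps -> m%:R <= Theta / eps ^+ k ->
  8 * eps ^+ 2 <= 8 * Theta `^ (2 / k%:R) / N%:R `^ (2 / k%:R).
Proof.
move=> k_gt0 /andP[N_gt0 Nm] eps_gt0.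
have epsk_gt0 : 0 < eps ^+ k by rewrite exprn_gt0.
rewrite ler_pdivlMr// => mTheta.
have kR : k%:R != 0 :> R by rewrite pnatr_eq0 -lt0n.
have e_ge0 : 0 <= 2 / k%:R :> R by rewrite divr_ge0.
rewrite -mulrA ler_pM2l// ler_pdivlMr ?powR_gt0 ?ltr0n//.
have -> : eps ^+ 2 = (eps ^+ k) `^ (2 / k%:R).
  rewrite -[eps ^+ k]powR_mulrn ?(ltW eps_gt0)// -powRrM mulrC divfK//.
  by rewrite powR_mulrn ?(ltW eps_gt0).
rewrite -powRM ?(ltW epsk_gt0)//; apply: ge0_ler_powR => //.
- by rewrite nnegrE mulr_ge0// ltW.
- by rewrite nnegrE (le_trans _ mTheta)// mulr_ge0// ltW.
by rewrite (le_trans _ mTheta)// mulrC ler_pM2r// ler_nat.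
Qed.

(** The two bounds on [m] combine to [m eps^k <= Theta <= m r^k]. *)
Lemma covering_radius_le (R : realType) (k m : nat) (Theta eps r : R) :
  (0 < k)%N -> 0 < eps -> 0 < r -> m%:R <= Theta / eps ^+ k ->
  Theta / r ^+ k <= m%:R -> (0 < m)%N -> eps <= r.
Proof.
move=> k_gt0 eps_gt0 r_gt0 m_le m_ge m_gt0.
have epsk_gt0 : 0 < eps ^+ k by rewrite exprn_gt0.
have rk_gt0 : 0 < r ^+ k by rewrite exprn_gt0.
have m_gt0R : 0 < m%:R :> R by rewrite ltr0n.
rewrite -(ler_pXn2r k_gt0) ?nnegrE ?(ltW eps_gt0) ?(ltW r_gt0)//.
move: m_le m_ge; rewrite ler_pdivlMr// ler_pdivrMr// => m_le m_ge.
by rewrite -(ler_pM2l m_gt0R) (le_trans m_le).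
Qed.

Lemma outer_polytope_dilateE (R : realType) (d m : nat) (C V : set 'rV[R]_d) :
  (V #= `I_m)%card -> exists2 u : 'I_m -> 'rV[R]_d, (forall i, V (u i)) &
    outer_polytope C (dilate 2 V) = hpoly (fun i => unit_dir C (2 *: u i))
      (fun i => support_fun (unit_dir C (2 *: u i)) C).
Proof.
rewrite card_eq_sym => /card_set_bijP[f [fV _ fsurj]].
exists (fun i : 'I_m => f i) => [i|]; first exact/fV/ltn_ord.
apply/seteqP; split=> [x Px i|x Px _ [_ [v Vv <-] <-]].
  apply: Px; exists (2 *: f i) => //; exists (f i) => //.
  exact/fV/ltn_ord.
have [i im <-] := fsurj _ Vv.
exact: (Px (Ordinal im)).
Qed.

(** * Assembly of the estimates *)

Theorem mainTheorem3 (R : realType) (d : nat) (hd : (2 <= d)%N)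
    (U : nat -> set 'rV[R]_d) (hU : efficient_covering U)
    (C : set 'rV[R]_d) (hC : convex_body C) (hCB : C `<=` @unit_ball R d) :
  exists c : R, \forall m \near \oo,
    let P := outer_polytope C (dilate 2 (U m)) in
    compact_convex_polytope P /\
    hausdorff_dist C P <= c / (num_hyperfaces P)%:R `^ (2 / d.-1%:R).
Proof.
have [cC vC [z zC]] := hC.
have C0 : C !=set0 by exists z; exact: interior_subset.
have [K covering] := hU.
have d1_gt0 : (0 < d.-1)%N by rewrite -subn1 subn_gt0.
exists (8 * K `^ (2 / d.-1%:R)).
(* This size of [m] forces [eps <= 1/2], as the quadratic estimate requires. *)
have m_large : \forall m \near \oo, K / (1 / 2) ^+ d.-1 <= m%:R.
  exact: nbhs_infty_ger.
apply: filterS3 covering m_large (nbhs_infty_gt 0) => m.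
move=> [US card_U [eps [eps_gt0 Unet m_le]]] m_ge m_gt0.
have eps_itv : 0 < eps <= 1 / 2.
  have half_gt0 : 0 < 1 / 2 :> R by rewrite divr_gt0.
  by rewrite eps_gt0 (covering_radius_le _ _ _ _ _ _ d1_gt0 _ _ m_le m_ge).
have Pdot x : outer_polytope C (dilate 2 (U m)) x -> dot x x <= 4 ^+ 2.
  exact: outer_polytope_bounded Unet.
have Pnear x : outer_polytope C (dilate 2 (U m)) x ->
    exists2 y, C y & rho x y <= 8 * eps ^+ 2.
  move=> Px; exists (proj x C); first by have [] := proj_nearest x C cC C0.
  exact: outer_polytope_near Px.
have CP : C `<=` outer_polytope C (dilate 2 (U m)).
  exact: subset_outer_polytope.
have [u uU PE] := outer_polytope_dilateE _ _ _ C _ card_U.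
rewrite PE /= in Pdot Pnear CP *.
set a := fun i => unit_dir C _; set b := fun i => support_fun _ _.
(* A point of norm 2 lies outside [C], so its direction is a genuine unit vector. *)
have a1 i : dot (a i) (a i) = 1.
  suff p2u : proj (2 *: u i) C != 2 *: u i by have [] := unit_dirP _ _ p2u.
  apply/eqP => p2u; have [Cp _] := proj_nearest (2 *: u i) C cC C0.
  have := hCB _ Cp; rewrite p2u /unit_ball/= enorm_le// dotZl dotZr.
  by rewrite -enorm_sqr (US _ (uU i)); lra.
have a0 i : a i != 0.
  apply/eqP => ai0; have := a1 i; rewrite ai0 -(scale0r 0) dotZl mul0r; lra.
(* An interior point of [C] can move a little along [a i] inside [C]; that move is its slack in
   constraint [i]. *)
have zint : exists z, forall i, dot (a i) z < b i.
  exists z => i; have [t t_gt0 /CP/(_ i)] := interior_shift _ _ (a i) zC.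
  by rewrite -/(a i) -/(b i) dotDr dotZr a1; lra.
(* The vector with all coordinates 5 violates the bound 16 on the squared norm. *)
have PT : hpoly a b != setT.
  apply/eqP => PT; pose i : 'I_d := Ordinal (ltnW hd).
  have : hpoly a b (const_mx 5) by rewrite PT.
  move=> /Pdot P5; have := le_trans (dot_coord_le _ i) P5; rewrite mxE; lra.
have /andP[N_gt0 N_le] := num_hyperfaces_bounds _ _ a0 PT zint.
split.
  split; last by exists m, a, b.
  apply: bounded_closed_compact; last exact: hpoly_closed.
  exact: (dot_bounded_set _ 4 Pdot).
apply: (@le_trans _ _ (8 * eps ^+ 2)).
  by apply: hausdorff_dist_le => //; rewrite mulr_ge0// sqr_ge0.
by apply: (powR_covering_bound _ _ m) => //; rewrite N_gt0.
Qed.
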